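(* Let $\kappa>0$ and consider the autonomous system on $\mathcal{M}\times\mathcal{M}$ $$\dot\rho(t)=-i[H_0+f(\rho,\rho_d)H_1,\rho(t)],\qquad \dot\rho_d(t)=-i[H_0,\rho_d(t)],\qquad f(\rho,\rho_d)=\kappa\,\mathrm{Tr}([-iH_1,\rho]\rho_d).$$ Then every trajectory $(\rho(t),\rho_d(t))$ of this system converges, as $t\to+\infty$, to the invariant set $$E=\{(\rho_1,\rho_2)\in\mathcal{M}\times\mathcal{M}:\ \dot V(\rho(t),\rho_d(t))=0 \text{ for all } t \text{ along the solution with } (\rho(0),\rho_d(0))=(\rho_1,\rho_2)\},$$ i.e. the distance from $(\rho(t),\rho_d(t))$ to $E$ tends to $0$.
   Context: $H_0,H_1$ are fixed (time-independent) Hermitian $n\times n$ matrices. A density operator is a positive semidefinite Hermitian $n\times n$ matrix of trace $1$. A target density operator $\rho_d(0)$ is fixed, and $\mathcal{M}$ denotes the compact manifold of all density operators with the same spectrum (with multiplicities) as $\rho_d(0)$. $V(\rho,\rho_d)=\frac12\mathrm{Tr}[(\rho-\rho_d)^2]$ on $\mathcal{M}\times\mathcal{M}$. $[A,B]=AB-BA$. Distances are measured with the Hilbert-Schmidt norm $\|A\|=\sqrt{\mathrm{Tr}(A^\dagger A)}$. *)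

(* Defs.v *)
From HB Require Import structures.
From mathcomp Require Import all_boot all_order all_algebra.
From mathcomp Require Import sesquilinear spectral.
From mathcomp Require Import complex.
From mathcomp Require Import all_classical all_reals all_analysis.

Set Implicit Arguments.
Unset Strict Implicit.
Unset Printing Implicit Defensive.

Import Order.TTheory GRing.Theory Num.Theory.
Import numFieldNormedType.Exports.

Local Open Scope classical_set_scope.
Local Open Scope ring_scope.
Local Open Scope sesquilinear_scope.
Local Open Scope complex_scope.

Section Definitions.
Context {R : realType} {n : nat}.
Local Notation op := 'M[R[i]]_n.
Implicit Types (A B rho rhod sigma : op) (kappa : R) (D : set R).

Definition commutator A B : op := A *m B - B *m A.

(* The trace of A^t* A is a nonnegative real number, so nothing is lost by
   taking its real part. *)
Definition hsnorm A : R := Num.sqrt (complex.Re (\tr (A^t* *m A))).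

Definition density A : Prop :=
  [/\ A \is hermsymmx,
      forall v : 'cV[R[i]]_n, 0 <= (v^t* *m A *m v) 0 0
    & \tr A = 1].

Definition same_spectrum A B : Prop :=
  forall lam : R[i], mup lam (char_poly A) = mup lam (char_poly B).

Definition isospectral_manifold sigma : set op :=
  [set rho | density rho /\ same_spectrum rho sigma].

(* The trace is real for Hermitian arguments, in particular on the manifold. *)
Definition lyapunov rho rhod : R :=
  complex.Re (2^-1 * \tr ((rho - rhod) *m (rho - rhod))).

(* A complex number by type; real for Hermitian H1, rho and rhod. *)
Definition feedback (H1 : op) kappa rho rhod : R[i] :=
  kappa%:C * \tr (commutator (- 'i%C *: H1) rho *m rhod).

(* gamma'(t) = L in the Hilbert-Schmidt norm, the derivative being taken
   relative to the time domain D: it is one-sided at an end point of an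
   interval D, and the usual derivative at interior points. *)
Definition has_derivative_within D (gamma : R -> op) (t : R) (L : op) : Prop :=
  hsnorm ((s - t)^-1%:C *: (gamma s - gamma t) - L)
    @[s --> within D t^'] --> (0 : R).

(* (rho, rhod) is a solution, with time domain D, of the closed-loop system on
   the product of the isospectral manifold of sigma with itself. *)
Definition solution_on D (H0 H1 : op) sigma kappa (rho rhod : R -> op) : Prop :=
  forall t, D t ->
    [/\ isospectral_manifold sigma (rho t),
        isospectral_manifold sigma (rhod t),
        has_derivative_within D rho t
          (- 'i%C *: commutator
             (H0 + feedback H1 kappa (rho t) (rhod t) *: H1) (rho t))
      & has_derivative_within D rhod t (- 'i%C *: commutator H0 (rhod t))].

(* The manifold is compact, so solutions are defined for all real times; they
   are unique, hence the existential picks out the solution starting at p. *)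
Definition invariant_set (H0 H1 : op) sigma kappa : set (op * op) :=
  [set p | isospectral_manifold sigma p.1 /\ isospectral_manifold sigma p.2 /\
     exists rho rhod : R -> op,
       [/\ solution_on setT H0 H1 sigma kappa rho rhod,
           rho 0 = p.1, rhod 0 = p.2
         & forall t : R, is_derive t 1 (fun s => lyapunov (rho s) (rhod s)) 0]].

Definition pair_dist (p q : op * op) : R :=
  Num.sqrt (hsnorm (p.1 - q.1) ^+ 2 + hsnorm (p.2 - q.2) ^+ 2).

(* Extended-real valued, so that the distance to the empty set is +oo. *)
Definition dist_to_set (p : op * op) (E : set (op * op)) : \bar R :=
  ereal_inf [set (pair_dist p q)%:E | q in E].

End Definitions.

(* Main.v *)
Require Import Defs.
From HB Require Import structures.
From mathcomp Require Import all_boot all_order all_algebra.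
From mathcomp Require Import sesquilinear spectral.
From mathcomp Require Import complex.
From mathcomp Require Import ring lra.
From mathcomp Require Import all_classical all_reals all_analysis.

Set Implicit Arguments.
Unset Strict Implicit.
Unset Printing Implicit Defensive.

Import Order.TTheory GRing.Theory Num.Theory.
Import numFieldNormedType.Exports.

Local Open Scope classical_set_scope.
Local Open Scope ring_scope.
Local Open Scope sesquilinear_scope.
Local Open Scope complex_scope.

(** LaSalle's argument, run with ultrafilters.  Along a solution V decreases at
    rate f^2 / kappa, so V converges.  For an ultrafilter F finer than the
    filter t -> +oo, the translates t |-> (rho (t + s), rhod (t + s)) have an
    F-limit y s for every real s, because density matrices are bounded.  The
    vector field is Lipschitz along the solution, so the solution satisfies a
    Taylor bound with remainder K h^2, uniformly in t > 0; this bound passes to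
    the limit and says that y is a solution on the whole line.  It stays in the
    manifold, which is closed, and V is constant along it, so y 0 belongs to the
    invariant set.  Hence the distance tends to 0 along every such F.  Neither
    existence nor uniqueness of solutions is needed. *)

(** * Algebras of real functions and the matrix functions built on them *)

Section FunctionAlgebra.
Context {R : realType} {X : Type}.
Implicit Type P : set (X -> R).

(** Every expression of the proof (field, feedback, Lyapunov function, determinant) is a polynomial
    in the real and imaginary parts of matrix entries. Closure under constants, sums and products
    thus treats boundedness, Lipschitz bounds and convergence by the same lemmas. *)
Definition function_algebra P : Prop :=
  [/\ forall c, P (fun=> c),
      forall f g, P f -> P g -> P (fun x => f x + g x)
    & forall f g, P f -> P g -> P (fun x => f x * g x)].

Definition complex_in P (u : X -> R[i]) : Prop :=
  P (fun x => complex.Re (u x)) /\ P (fun x => complex.Im (u x)).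

Definition matrix_in P m p (A : X -> 'M[R[i]]_(m, p)) : Prop :=
  forall i j, complex_in P (fun x => A x i j).

Variable P : set (X -> R).
Hypothesis algP : function_algebra P.

Let P_cst c : P (fun=> c). Proof. by case: algP. Qed.
Let P_add f g : P f -> P g -> P (fun x => f x + g x).
Proof. by case: algP => _ + _; apply. Qed.
Let P_mul f g : P f -> P g -> P (fun x => f x * g x).
Proof. by case: algP => _ _; apply. Qed.
Let P_opp f : P f -> P (fun x => - f x).
Proof.
move=> Pf; rewrite (_ : (fun x => - f x) = fun x => -1 * f x); first exact: P_mul.
by apply/funext => x; rewrite mulN1r.
Qed.

Lemma complex_in_cst c : complex_in P (fun=> c).
Proof. by split; apply: P_cst. Qed.

Lemma complex_in_add u v :
  complex_in P u -> complex_in P v -> complex_in P (fun x => u x + v x).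
Proof.
move=> [u1 u2] [v1 v2]; split.
  rewrite (_ : (fun _ => _) = fun x =>
    complex.Re (u x) + complex.Re (v x)); first exact: P_add.
  by apply/funext => x; case: (u x); case: (v x).
rewrite (_ : (fun _ => _) = fun x =>
    complex.Im (u x) + complex.Im (v x)); first exact: P_add.
by apply/funext => x; case: (u x); case: (v x).
Qed.

Lemma complex_in_mul u v :
  complex_in P u -> complex_in P v -> complex_in P (fun x => u x * v x).
Proof.
move=> [u1 u2] [v1 v2]; split.
  rewrite (_ : (fun _ => _) = fun x => complex.Re (u x) * complex.Re (v x)
                               + - (complex.Im (u x) * complex.Im (v x))).
    by apply: P_add; [|apply: P_opp]; apply: P_mul.
  by apply/funext => x; case: (u x); case: (v x).
rewrite (_ : (fun _ => _) = fun x => complex.Re (u x) * complex.Im (v x)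
                             + complex.Im (u x) * complex.Re (v x)).
  by apply: P_add; apply: P_mul.
by apply/funext => x; case: (u x); case: (v x).
Qed.

Lemma complex_in_conj u : complex_in P u -> complex_in P (fun x => (u x)^*).
Proof.
move=> [u1 u2]; split.
  rewrite (_ : (fun _ => _) = fun x => complex.Re (u x)) //.
  by apply/funext => x; case: (u x).
rewrite (_ : (fun _ => _) = fun x => - complex.Im (u x)); first exact: P_opp.
by apply/funext => x; case: (u x).
Qed.

Lemma complex_in_sum (I : Type) (r : seq I) (Q : pred I) (u : I -> X -> R[i]) :
  (forall i, complex_in P (u i)) ->
  complex_in P (fun x => \sum_(i <- r | Q i) u i x).
Proof.
move=> Pu; elim: r => [|i r IH].
  rewrite (_ : (fun _ => _) = fun=> 0); first exact: complex_in_cst.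
  by apply/funext => x; rewrite big_nil.
rewrite (_ : (fun _ => _) = fun x => (if Q i then u i x else 0) +
                               \sum_(i <- r | Q i) u i x).
  by apply: complex_in_add => //; case: (Q i) => //; apply: complex_in_cst.
by apply/funext => x; rewrite big_cons; case: (Q i); rewrite ?add0r.
Qed.

Lemma complex_in_prod (I : Type) (r : seq I) (Q : pred I) (u : I -> X -> R[i]) :
  (forall i, complex_in P (u i)) ->
  complex_in P (fun x => \prod_(i <- r | Q i) u i x).
Proof.
move=> Pu; elim: r => [|i r IH].
  rewrite (_ : (fun _ => _) = fun=> 1); first exact: complex_in_cst.
  by apply/funext => x; rewrite big_nil.
rewrite (_ : (fun _ => _) = fun x => (if Q i then u i x else 1) *
                               \prod_(i <- r | Q i) u i x).
  by apply: complex_in_mul => //; case: (Q i) => //; apply: complex_in_cst.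
by apply/funext => x; rewrite big_cons; case: (Q i); rewrite ?mul1r.
Qed.

Lemma matrix_in_cst m p (A : 'M[R[i]]_(m, p)) : matrix_in P (fun=> A).
Proof. by move=> i j; apply: complex_in_cst. Qed.

Lemma matrix_in_add m p (A B : X -> 'M[R[i]]_(m, p)) :
  matrix_in P A -> matrix_in P B -> matrix_in P (fun x => A x + B x).
Proof.
move=> PA PB i j; rewrite (_ : (fun _ => _) = fun x => A x i j + B x i j).
  exact: complex_in_add.
by apply/funext => x; rewrite !mxE.
Qed.

Lemma matrix_in_scale m p (u : X -> R[i]) (A : X -> 'M[R[i]]_(m, p)) :
  complex_in P u -> matrix_in P A -> matrix_in P (fun x => u x *: A x).
Proof.
move=> Pu PA i j; rewrite (_ : (fun _ => _) = fun x => u x * A x i j).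
  exact: complex_in_mul.
by apply/funext => x; rewrite !mxE.
Qed.

Lemma matrix_in_sub m p (A B : X -> 'M[R[i]]_(m, p)) :
  matrix_in P A -> matrix_in P B -> matrix_in P (fun x => A x - B x).
Proof.
move=> PA PB; rewrite (_ : (fun _ => _) = fun x => A x + (-1) *: B x).
  by apply: matrix_in_add => //; apply: matrix_in_scale => //; apply: complex_in_cst.
by apply/funext => x; rewrite scaleN1r.
Qed.

Lemma matrix_in_mul m p q (A : X -> 'M[R[i]]_(m, p)) (B : X -> 'M[R[i]]_(p, q)) :
  matrix_in P A -> matrix_in P B -> matrix_in P (fun x => A x *m B x).
Proof.
move=> PA PB i j; rewrite (_ : (fun _ => _) = fun x => \sum_k A x i k * B x k j).
  by apply: complex_in_sum => k; apply: complex_in_mul.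
by apply/funext => x; rewrite !mxE.
Qed.

Lemma matrix_in_adjoint m p (A : X -> 'M[R[i]]_(m, p)) :
  matrix_in P A -> matrix_in P (fun x => (A x)^t*).
Proof.
move=> PA i j; rewrite (_ : (fun _ => _) = fun x => (A x j i)^*).
  exact: complex_in_conj.
by apply/funext => x; rewrite !mxE.
Qed.

Lemma complex_in_tr m (A : X -> 'M[R[i]]_m) :
  matrix_in P A -> complex_in P (fun x => \tr (A x)).
Proof. by move=> PA; apply: complex_in_sum. Qed.

(** By the Leibniz formula. This serves to pass characteristic polynomials to the limit. *)
Lemma complex_in_det m (A : X -> 'M[R[i]]_m) :
  matrix_in P A -> complex_in P (fun x => \det (A x)).
Proof.
move=> PA; apply: complex_in_sum => s; apply: complex_in_mul.
  exact: complex_in_cst.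
exact: complex_in_prod.
Qed.

Lemma matrix_in_commutator m (A B : X -> 'M[R[i]]_m) :
  matrix_in P A -> matrix_in P B -> matrix_in P (fun x => commutator (A x) (B x)).
Proof. by move=> PA PB; apply: matrix_in_sub; apply: matrix_in_mul. Qed.

Lemma complex_in_feedback m (H1 : 'M[R[i]]_m) kappa (A B : X -> 'M[R[i]]_m) :
  matrix_in P A -> matrix_in P B ->
  complex_in P (fun x => feedback H1 kappa (A x) (B x)).
Proof.
move=> PA PB; apply: complex_in_mul; first exact: complex_in_cst.
apply/complex_in_tr/matrix_in_mul => //.
by apply: matrix_in_commutator => //; apply: matrix_in_cst.
Qed.

Lemma matrix_in_field m (H0 H1 : 'M[R[i]]_m) kappa (A B : X -> 'M[R[i]]_m) :
  matrix_in P A -> matrix_in P B ->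
  matrix_in P (fun x => - 'i%C *:
    commutator (H0 + feedback H1 kappa (A x) (B x) *: H1) (A x)).
Proof.
move=> PA PB; apply: matrix_in_scale; first exact: complex_in_cst.
apply: matrix_in_commutator => //; apply: matrix_in_add.
  exact: matrix_in_cst.
by apply: matrix_in_scale; [apply: complex_in_feedback|apply: matrix_in_cst].
Qed.

Lemma function_algebra_lyapunov m (A B : X -> 'M[R[i]]_m) :
  matrix_in P A -> matrix_in P B -> P (fun x => lyapunov (A x) (B x)).
Proof.
move=> PA PB; suff [] : complex_in P
  (fun x => 2^-1 * \tr ((A x - B x) *m (A x - B x))) by [].
apply: complex_in_mul; first exact: complex_in_cst.
by apply/complex_in_tr/matrix_in_mul; apply: matrix_in_sub.
Qed.

End FunctionAlgebra.

(** * The Hilbert-Schmidt norm in terms of entries *)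

Section Norm.
Context {R : realType} {n : nat}.
Implicit Type A : 'M[R[i]]_n.

Lemma hsnormE A : hsnorm A =
  Num.sqrt (\sum_j \sum_i (complex.Re (A i j) ^+ 2 + complex.Im (A i j) ^+ 2)).
Proof.
congr (Num.sqrt _); rewrite [LHS](raddf_sum (@complex.Re R : Rcomplex R -> R)).
apply: eq_bigr => j _; rewrite mxE.
rewrite [LHS](raddf_sum (@complex.Re R : Rcomplex R -> R)).
by apply: eq_bigr => i _; rewrite !mxE; case: (A i j) => a b /=; ring.
Qed.

Lemma Re_Im_le_hsnorm A i j :
  `|complex.Re (A i j)| <= hsnorm A /\ `|complex.Im (A i j)| <= hsnorm A.
Proof.
suff H : complex.Re (A i j) ^+ 2 + complex.Im (A i j) ^+ 2 <= hsnorm A ^+ 2.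
  by split; rewrite -(@ler_pXn2r _ 2) ?nnegrE ?sqrtr_ge0 // real_normK ?num_real //;
  apply: le_trans H; rewrite ?lerDl ?lerDr sqr_ge0.
have pos k l : 0 <= complex.Re (A k l) ^+ 2 + complex.Im (A k l) ^+ 2.
  by rewrite addr_ge0 ?sqr_ge0.
have pos' l : 0 <= \sum_k (complex.Re (A k l) ^+ 2 + complex.Im (A k l) ^+ 2).
  by apply: sumr_ge0.
rewrite hsnormE sqr_sqrtr ?sumr_ge0 //.
rewrite (bigD1 j) //= (bigD1 i) //= -addrA lerDl addr_ge0 ?sumr_ge0 //.
Qed.

End Norm.

(** * Entrywise convergence and convergence in norm *)

Section Convergence.
Context {R : realType} {T : Type}.

(* Limits are recorded as the value at [None], so that the algebraic
   combination of convergent functions is one instance of [function_algebra]. *)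
Definition converges (F : set_system T) : set (option T -> R) :=
  [set f : option T -> R | f (Some t) @[t --> F] --> f None].

Definition with_limit {U : Type} (f : T -> U) (l : U) : option T -> U :=
  fun o => if o is Some t then f t else l.

Lemma function_algebra_converges (F : set_system T) :
  Filter F -> function_algebra (converges F).
Proof.
move=> FF; split=> [c|f g cf cg|f g cf cg].
- exact: cvg_cst.
- exact: cvgD cf cg.
- exact: cvgM cf cg.
Qed.

Definition matrix_cvg (F : set_system T) m p (A : T -> 'M[R[i]]_(m, p)) L :=
  matrix_in (converges F) (with_limit A L).

(** The radicand is a polynomial in the entries and their conjugates, and the square root is
    continuous. *)
Lemma hsnorm_cvg (F : set_system T) {FF : Filter F} n (A : T -> 'M[R[i]]_n) L :
  matrix_cvg F A L -> hsnorm (A t) @[t --> F] --> hsnorm L.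
Proof.
move=> cA; have alg := function_algebra_converges FF.
have [c _] := complex_in_tr alg (matrix_in_mul alg (matrix_in_adjoint alg cA) cA).
exact: (cvg_comp _ _ c (@sqrt_continuous R _)).
Qed.

Lemma matrix_cvg_hsnorm (F : set_system T) {FF : Filter F} n
    (A : T -> 'M[R[i]]_n) L :
  hsnorm (A t - L) @[t --> F] --> (0 : R) -> matrix_cvg F A L.
Proof.
move=> cA.
have sq (f : T -> R) (l : R) : (forall t, `|f t - l| <= hsnorm (A t - L)) ->
    f t @[t --> F] --> l.
  move=> fl; apply/cvgrPdist_le => e e0; near=> t; rewrite distrC.
  rewrite (le_trans (fl t))// -[leLHS]ger0_norm ?sqrtr_ge0//.
  by near: t; apply: cvgr0_norm_le.
move=> i j; split; apply: sq => t /=.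
  have [+ _] := Re_Im_le_hsnorm (A t - L) i j.
  by rewrite !mxE; case: (A t i j); case: (L i j).
have [_ +] := Re_Im_le_hsnorm (A t - L) i j.
by rewrite !mxE; case: (A t i j); case: (L i j).
Unshelve. all: by end_near.
Qed.

End Convergence.

(** * Bounds, derivatives and Taylor estimates at positive times *)

Section HalfLine.
Context {R : realType}.
Implicit Types (u v : R -> R).

Definition bounded_on_pos : set (R -> R) :=
  [set u | exists M, forall t, 0 < t -> `|u t| <= M].

(** Boundedness is bundled in because a product of Lipschitz functions need not be Lipschitz without
    it. *)
Definition bounded_lipschitz_on_pos : set (R -> R) :=
  [set u | exists M, forall s t, 0 < s -> 0 < t ->
     `|u t| <= M /\ `|u s - u t| <= M * `|s - t|].

Lemma function_algebra_bounded : function_algebra bounded_on_pos.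
Proof.
split=> [c|u v [M uM] [N vN]|u v [M uM] [N vN]].
- by exists `|c|.
- exists (M + N) => t t0; apply: le_trans (ler_normD _ _) _.
  by rewrite lerD ?uM ?vN.
- by exists (M * N) => t t0; rewrite normrM ler_pM ?uM ?vN.
Qed.

Lemma function_algebra_bounded_lipschitz :
  function_algebra bounded_lipschitz_on_pos.
Proof.
split=> [c|u v [M uM] [N vN]|u v [M uM] [N vN]].
- exists `|c| => s t s0 t0; split=> //.
  by rewrite subrr normr0 mulr_ge0.
- exists (M + N) => s t s0 t0.
  have [ut ust] := uM s t s0 t0; have [vt vst] := vN s t s0 t0; split.
    by apply: le_trans (ler_normD _ _) _; rewrite lerD.
  rewrite mulrDl opprD addrACA; apply: le_trans (ler_normD _ _) _.
  exact: lerD.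
(* One [M * N] for each term of [u s * (v s - v t) + v t * (u s - u t)]. *)
- exists (M * N + M * N) => s t s0 t0.
  have [us _] := uM t s t0 s0.
  have [ut ust] := uM s t s0 t0; have [vt vst] := vN s t s0 t0.
  have M0 : 0 <= M by apply: le_trans ut.
  have N0 : 0 <= N by apply: le_trans vt.
  split.
    rewrite normrM (@le_trans _ _ (M * N)) ?ler_pM //.
    by rewrite lerDl mulr_ge0.
  rewrite (_ : u s * v s - u t * v t = u s * (v s - v t) + v t * (u s - u t)); last ring.
  apply: le_trans (ler_normD _ _) _; rewrite !normrM mulrDl lerD //.
    by rewrite -mulrA ler_pM.
  by rewrite [M * N]mulrC -mulrA ler_pM.
Qed.

(** Since [D] is a neighbourhood of [t], restricting the difference quotient to [D] changes nothing
    near [t]; the substitution [s = h + t] gives the usual form. *)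
Lemma within_slope_is_derive (D : set R) u (t d : R) : nbhs t D ->
  (s - t)^-1 * (u s - u t) @[s --> within D t^'] --> d -> is_derive t 1 u d.
Proof.
move=> Dt cu.
suff c : h^-1 *: ((u \o shift t) (h *: 1) - u t) @[h --> 0^'] --> d.
  by split; [apply/cvg_ex; exists d|exact: cvg_lim c].
apply/cvgrPdist_le => e e0.
have H : \forall s \near within D t^', `|d - (s - t)^-1 * (u s - u t)| <= e.
  by move/cvgrPdist_le: cu; apply.
have {H} : \forall s \near t, s != t -> `|d - (s - t)^-1 * (u s - u t)| <= e.
  by move: H; apply: filterS2 Dt => s Ds /= H st; apply: H.
rewrite (near_shift 0 t) subr0; apply: filterS => h /= + h0.
by rewrite addrK scaler1; apply; rewrite -subr_eq0 addrK.
Qed.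

Section Derivative.
Variables u v : R -> R.
Hypothesis uv : forall t : R, 0 < t -> is_derive t 1 u (v t).

Lemma mvt_on_pos s t : 0 < s -> s <= t ->
  exists2 c, s <= c <= t & u t - u s = v c * (t - s).
Proof.
move=> s0 st; have [||c] := @MVT_segment _ u v _ _ st.
- by move=> x; rewrite in_itv /= => /andP[/(lt_trans s0) ? _]; apply: uv.
- apply: derivable_within_continuous => x; rewrite in_itv /=.
  by move=> /andP[/(lt_le_trans s0) /uv [] ].
by rewrite in_itv /=; exists c.
Qed.

Lemma nonincreasing_on_pos s t : (forall r : R, 0 < r -> v r <= 0) ->
  0 < s -> s <= t -> u t <= u s.
Proof.
move=> v0 s0 st; have [c /andP[sc _] e] := mvt_on_pos s0 st.
by rewrite -subr_le0 e mulr_le0_ge0 ?subr_ge0// v0// (lt_le_trans s0).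
Qed.

Lemma bounded_derivative_lipschitz : bounded_on_pos u -> bounded_on_pos v ->
  bounded_lipschitz_on_pos u.
Proof.
move=> [M uM] [N vN]; exists (`|M| + `|N|) => s t s0 t0; split.
  by rewrite (le_trans (uM t t0))// (le_trans (ler_norm _))// lerDl.
have main a b : 0 < a -> a <= b -> `|u b - u a| <= (`|M| + `|N|) * `|b - a|.
  move=> a0 ab; have [c /andP[ac _] ->] := mvt_on_pos a0 ab.
  rewrite normrM ler_wpM2r// (le_trans (vN c (lt_le_trans a0 ac)))//.
  by rewrite (le_trans (ler_norm _))// lerDr.
have [st|/ltW ts] := leP s t; last exact: main.
by rewrite distrC (distrC s); apply: main.
Qed.

(** The mean value theorem gives [u s - u t = v c * (s - t)] with [c] between [s] and [t], and
    [v c - v t] is at most a constant times [|s - t|]. The constant [K] does not depend on the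
    times, so the bound survives translation to infinity. *)
Lemma taylor_on_pos : bounded_lipschitz_on_pos v ->
  exists K, forall s t, 0 < s -> 0 < t ->
    `|u s - u t - (s - t) * v t| <= K * (s - t) ^+ 2.
Proof.
move=> [N vN]; exists `|N| => s t s0 t0.
suff [c c0 [ct e]] : exists2 c, 0 < c & `|c - t| <= `|s - t| /\
    u s - u t = v c * (s - t).
  rewrite e mulrC -mulrBr normrM -real_normK ?num_real// expr2 mulrA mulrC.
  rewrite ler_wpM2r//; have [_ +] := vN c t c0 t0.
  by move=> /le_trans; apply; rewrite ler_pM ?ler_norm //;
    apply: le_trans (vN c t c0 t0).1.
have [st|/ltW ts] := leP s t.
  have [c /andP[sc ct] e] := mvt_on_pos s0 st; exists c.
    exact: lt_le_trans sc.
  split; last by rewrite -[LHS]opprB e; ring.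
  by rewrite !ler0_norm ?subr_le0// lerN2 lerB.
have [c /andP[tc cs] e] := mvt_on_pos t0 ts; exists c.
  exact: lt_le_trans tc.
by split => //; rewrite !ger0_norm ?subr_ge0// lerB.
Qed.

End Derivative.

End HalfLine.

(** * Limits along ultrafilters *)

Section Ultrafilter.
Context {R : realType} {T : Type}.

(** Compactness of [[-M, M]] gives a cluster point, and an ultrafilter converges to each of its
    cluster points: it contains the preimage of [B] or that of its complement, and the latter is
    excluded when [B] is a neighbourhood. *)
Lemma bounded_ultra_cvg (F : set_system T) (u : T -> R) (M : R) :
  UltraFilter F -> (\forall t \near F, `|u t| <= M) -> cvg (u t @[t --> F]).
Proof.
move=> UF uM; have FF : ProperFilter F by apply: ultra_proper.
have [|p [_ pc]] := @segment_compact R (- M) M (u @ F) _.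
  by apply: filterS uM => t /=; rewrite in_itv /= -ler_norml.
apply/cvg_ex; exists p => B Bp; have [//|nB] := in_ultra_setVsetC (u @^-1` B) UF.
by have [x []] := pc (~` B) B nB Bp.
Qed.

(** If the preimage of a neighbourhood [B] is not in [F], then [F] restricted to the preimage of the
    complement is proper. An ultrafilter above it would contain both preimages. *)
Lemma cvg_ultra {U : topologicalType} (F : set_system T) (u : T -> U) (l : U) :
  ProperFilter F ->
  (forall G, UltraFilter G -> F `<=` G -> u t @[t --> G] --> l) ->
  u t @[t --> F] --> l.
Proof.
move=> FF H B Bl; apply: contrapT => nFB.
pose G0 := within (u @^-1` (~` B)) F.
have PG0 : ProperFilter G0.
  split; last exact: within_filter.
  move=> G0F; apply: nFB; move: G0F; rewrite /G0 /within /=; apply: filterS => t /= nB.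
  by apply: contrapT => /nB.
have [G [UG G0G]] := ultraFilterLemma PG0.
have FG : F `<=` G by move=> A FA; apply: G0G; rewrite /G0 /within /=; apply: filterS FA.
have GB : G (u @^-1` B) := H G UG FG B Bl.
have GnB : G (u @^-1` (~` B)) by apply: G0G; rewrite /G0 /within /=; apply: filterE.
have PG : ProperFilter G by apply: ultra_proper.
by have [t []] := filter_ex (filterI GB GnB).
Qed.

(** Each [lim] is a default value when the limit does not exist, so [mxlim] is meaningful only once
    convergence is known. *)
Definition mxlim (F : set_system T) m p (A : T -> 'M[R[i]]_(m, p)) :=
  \matrix_(i, j) (lim (complex.Re (A t i j) @[t --> F])
               +i* lim (complex.Im (A t i j) @[t --> F])).

Lemma mxlim_cvg (F : set_system T) m p (A : T -> 'M[R[i]]_(m, p)) (M : R) :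
  UltraFilter F ->
  (forall i j, \forall t \near F,
     `|complex.Re (A t i j)| <= M /\ `|complex.Im (A t i j)| <= M) ->
  matrix_cvg F A (mxlim F A).
Proof.
move=> UF AM i j; have FF : ProperFilter F by apply: ultra_proper.
have cr : cvg (complex.Re (A t i j) @[t --> F]).
  by apply: (bounded_ultra_cvg UF (M := M)); apply: filterS (AM i j) => t [].
have ci : cvg (complex.Im (A t i j) @[t --> F]).
  by apply: (bounded_ultra_cvg UF (M := M)); apply: filterS (AM i j) => t [].
by split; rewrite /converges /= !mxE.
Qed.

End Ultrafilter.

(** * Equalities and inequalities in the limit *)

Section Closedness.
Context {R : realType} {T : Type} {F : set_system T} {FF : ProperFilter F}.

Lemma converges_ge0 (f : option T -> R) :
  converges F f -> (\forall t \near F, 0 <= f (Some t)) -> 0 <= f None.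
Proof.
move=> cf f0; have <- := cvg_lim (@Rhausdorff R) cf.
by apply: limr_ge => //; apply/cvg_ex; exists (f None).
Qed.

Lemma converges_eq (f : option T -> R) c :
  converges F f -> (\forall t \near F, f (Some t) = c) -> f None = c.
Proof.
move=> cf fc; have <- := cvg_lim (@Rhausdorff R) cf.
by apply: cvg_lim => //; apply: cvg_near_cst.
Qed.

Lemma complex_in_converges_eq (u : option T -> R[i]) c :
  complex_in (converges F) u -> (\forall t \near F, u (Some t) = c) -> u None = c.
Proof.
move=> [cr ci] uc; apply/eqP; rewrite eq_complex.
rewrite (converges_eq (c := complex.Re c) cr).
  rewrite (converges_eq (c := complex.Im c) ci) ?eqxx //.
  by apply: filterS uc => t ->.
by apply: filterS uc => t ->.
Qed.

Lemma complex_in_converges_ge0 (u : option T -> R[i]) :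
  complex_in (converges F) u -> (\forall t \near F, 0 <= u (Some t)) -> 0 <= u None.
Proof.
move=> [cr ci] u0; rewrite lecE; apply/andP; split.
  rewrite (converges_eq (c := 0) ci) //; apply: filterS u0 => t.
  by rewrite lecE => /andP[/eqP].
by apply: (converges_ge0 cr); apply: filterS u0 => t; rewrite lecE => /andP[].
Qed.

End Closedness.

(** * The isospectral manifold is closed and bounded *)

Section Manifold.
Context {R : realType} {n : nat}.
Local Notation op := 'M[R[i]]_n.
Implicit Types A B sigma : op.

Lemma hermsymmxP A : A \is hermsymmx <-> A^t* = A.
Proof.
split=> [/is_hermitianmxP|hA]; first by rewrite expr0 scale1r.
by apply/is_hermitianmxP; rewrite expr0 scale1r.
Qed.

(** The naturals below the size of [p - q] are distinct roots of it, more than its degree allows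
    unless it is zero. *)
Lemma polyP_horner (p q : {poly R[i]}) : (forall x, p.[x] = q.[x]) -> p = q.
Proof.
move=> pq; apply/eqP; rewrite -subr_eq0; apply/eqP.
apply: (@roots_geq_poly_eq0 _ _ [seq k%:R | k <- iota 0 (size (p - q))]).
- by apply/allP => x _; rewrite rootE hornerD hornerN pq subrr.
- by rewrite map_inj_uniq ?iota_uniq // => i j /eqP; rewrite eqr_nat => /eqP.
- by rewrite size_map size_iota.
Qed.

Lemma horner_char_poly A x : (char_poly A).[x] = \det (x%:M - A).
Proof.
rewrite -[LHS]/(horner_eval x (\det (char_poly_mx A))) -det_map_mx.
congr (\det _); apply/matrixP => i j; rewrite !mxE /horner_eval.
by rewrite /= /horner_eval hornerD hornerN hornerC hornerMn hornerX.
Qed.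

(** Both polynomials are monic and split over [R[i]], so the multiplicities of their roots determine
    them. Multiplicities do not pass to limits, but an equality of polynomials does. *)
Lemma same_spectrumE A B : same_spectrum A B <-> char_poly A = char_poly B.
Proof.
split=> [AB|AB lam]; last by rewrite AB.
have [r pr] := closed_field_poly_normal (char_poly A).
have [s ps] := closed_field_poly_normal (char_poly B).
move: pr ps; rewrite !(monicP (char_poly_monic _)) !scale1r => pr ps.
rewrite pr ps; apply: perm_big; apply/allP => x _ /=.
by rewrite -!mu_prod_XsubC -pr -ps AB.
Qed.

(** Each defining condition is an equality or a weak inequality between polynomials in the entries
    and their conjugates. For the spectrum, it is the value of [\det (x%:M - A)] at each fixed
    [x]. *)
Lemma isospectral_manifold_closed {T : Type} (F : set_system T)
    (PF : ProperFilter F) sigma (A : T -> op) L :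
  matrix_cvg F A L -> (\forall t \near F, isospectral_manifold sigma (A t)) ->
  isospectral_manifold sigma L.
Proof.
move=> cA mA; have alg : function_algebra (converges (R := R) F).
  exact: function_algebra_converges.
split; first split.
- apply/hermsymmxP/eqP; rewrite -subr_eq0; apply/eqP/matrixP => i j.
  rewrite [RHS]mxE; have cAA := matrix_in_sub alg (matrix_in_adjoint alg cA) cA i j.
  apply: (complex_in_converges_eq (c := 0) cAA).
  by apply: filterS mA => t [[/hermsymmxP /= -> _ _] _]; rewrite subrr mxE.
- move=> v; pose Q := matrix_in_mul alg (matrix_in_mul alg
    (matrix_in_cst alg (v^t*)) cA) (matrix_in_cst alg v).
  apply: (complex_in_converges_ge0 (Q 0 0)).
  by apply: filterS mA => t [[_ + _] _]; apply.
- apply: (complex_in_converges_eq (complex_in_tr alg cA)).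
  by apply: filterS mA => t [[]].
- apply/same_spectrumE/polyP_horner => x; rewrite !horner_char_poly.
  apply: (complex_in_converges_eq (complex_in_det alg
    (matrix_in_sub alg (matrix_in_cst alg x%:M) cA))).
  by apply: filterS mA => t [_ /same_spectrumE e] /=; rewrite -!horner_char_poly e.
Qed.

(** Positivity on [e_i + c e_j] with [c = 1, -1, i, -i] bounds both parts of [A i j] by the mean of
    the diagonal entries [A i i] and [A j j]. These have real parts in [[0, 1]], because all
    diagonal entries are nonnegative and sum to the trace. *)
Lemma density_entry_le1 A i j : density A ->
  `|complex.Re (A i j)| <= 1 /\ `|complex.Im (A i j)| <= 1.
Proof.
move=> [/hermsymmxP hA posA trA].
have form k l (c : R[i]) :
    0 <= A k k + c * A k l + (c^* * A l k + c^* * c * A l l).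
  have := posA (delta_mx k 0 + c *: delta_mx l 0).
  rewrite (_ : (_ + _)^t* = delta_mx 0 k + c^* *: delta_mx 0 l); last first.
    apply/matrixP => a b; rewrite !mxE rmorphD rmorphM /= !conjC_nat.
    by rewrite ![_ && (a == _)]andbC.
  rewrite !mulmxDl !mulmxDr -!scalemxAl -!scalemxAr.
  by rewrite -!rowE -!colE !mxE !mulrA.
have conjA k l : A l k = (A k l)^* by rewrite -{1}hA !mxE.
have diag k : 0 <= complex.Re (A k k).
  by have := form k k 0; rewrite lecE => /andP[_]; case: (A k k) => a b /=; lra.
have sumdiag : \sum_k complex.Re (A k k) = 1.
  have := congr1 (@complex.Re R) trA.
  by rewrite [X in X = _](raddf_sum (@complex.Re R : Rcomplex R -> R)).
have diag1 k : complex.Re (A k k) <= 1.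
  by rewrite -sumdiag (bigD1 k) //= lerDl sumr_ge0.
have := diag1 i; have := diag1 j; have := conjA i j.
have := form i j 1; have := form i j (-1).
have := form i j 'i%C; have := form i j (- 'i%C).
rewrite !lecE => /andP[_ +] /andP[_ +] /andP[_ +] /andP[_ +].
case: (A i j) (A j i) (A i i) (A j j) => [a b] [c d] [e f] [g h] /=.
by move=> ? ? ? ? [? ?] ? ?; rewrite !ler_norml; split; apply/andP; split; nra.
Qed.

End Manifold.

(** * Commutator identities and the sign of the Lyapunov rate *)

Section Decrease.
Context {R : realType} {n : nat}.
Local Notation op := 'M[R[i]]_n.

Lemma adjointM m p q (A : 'M[R[i]]_(m, p)) (B : 'M[R[i]]_(p, q)) :
  (A *m B)^t* = B^t* *m A^t*.
Proof. by rewrite trmx_mul map_mxM. Qed.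

Lemma adjointZ m p (c : R[i]) (A : 'M[R[i]]_(m, p)) :
  (c *: A)^t* = c^* *: A^t*.
Proof. by apply/matrixP => i j; rewrite !mxE rmorphM. Qed.

Lemma adjointB m p (A B : 'M[R[i]]_(m, p)) : (A - B)^t* = A^t* - B^t*.
Proof. by apply/matrixP => i j; rewrite !mxE rmorphB. Qed.

Lemma commutatorDl (A B C : op) :
  commutator (A + B) C = commutator A C + commutator B C.
Proof. by rewrite /commutator mulmxDl mulmxDr opprD addrACA. Qed.

Lemma commutatorBr (A B C : op) :
  commutator A (B - C) = commutator A B - commutator A C.
Proof.
by rewrite /commutator mulmxBl mulmxBr; apply/matrixP => i j; rewrite !mxE; ring.
Qed.

Lemma commutatorZl (c : R[i]) (A B : op) :
  commutator (c *: A) B = c *: commutator A B.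
Proof. by rewrite /commutator -scalemxAl -scalemxAr scalerBr. Qed.

Lemma tr_commutator_mul (A B : op) : \tr (commutator A B *m B) = 0.
Proof.
rewrite mulmxBl raddfB /= [X in _ - X]mxtrace_mulC mulmxA.
by rewrite mxtrace_mulC mulmxA subrr.
Qed.

Lemma tr_adjoint (A : op) : \tr (A^t*) = (\tr A)^*.
Proof.
rewrite /mxtrace (rmorph_sum (@conjc R)); apply: eq_bigr => i _.
by rewrite !mxE.
Qed.

(** The commutator of two Hermitian matrices is skew-Hermitian, so the factor [- 'i%C] makes it
    Hermitian, and the trace of a product of two Hermitian matrices is real. *)
Lemma tr_skew_commutator_real (H A B : op) :
  H^t* = H -> A^t* = A -> B^t* = B ->
  complex.Im (\tr (commutator (- 'i%C *: H) A *m B)) = 0.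
Proof.
move=> hH hA hB; set w := \tr _.
suff : w^* = w by case: w => a b [] /=; lra.
rewrite -tr_adjoint adjointM hB mxtrace_mulC; congr (\tr (_ *m _)).
rewrite commutatorZl adjointZ adjointB !adjointM hH hA -opprB scalerN -scaleNr.
by congr (_ *: _); apply/eqP; rewrite eq_complex /= !oppr0 opprK !eqxx.
Qed.

(** The difference of the two fields is [-i [H0, A - B] + f (-i [H1, A])]. Against [A - B] the drift
    term has trace zero by cyclicity, and the control term leaves [- f w = - kappa w^2], where [w =
    \tr ([-i H1, A] B)] is real. *)
Lemma lyapunov_rate_le0 (H0 H1 A B : op) (kappa : R) :
  H1 \is hermsymmx -> A \is hermsymmx -> B \is hermsymmx -> 0 < kappa ->
  complex.Re (\tr ((- 'i%C *: commutator (H0 + feedback H1 kappa A B *: H1) A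
     - - 'i%C *: commutator H0 B) *m (A - B))) <= 0.
Proof.
move=> /hermsymmxP hH /hermsymmxP hA /hermsymmxP hB k0.
have wreal := tr_skew_commutator_real hH hA hB.
rewrite (_ : \tr _ = - (feedback H1 kappa A B
                        * \tr (commutator (- 'i%C *: H1) A *m B))); last first.
  set f := feedback _ _ _ _.
  rewrite !commutatorDl !commutatorZl scalerDr addrAC -scalerBr -commutatorBr.
  rewrite mulmxDl mxtraceD -!scalemxAl !mxtraceZ tr_commutator_mul mulr0 add0r.
  by rewrite mulmxBr raddfB /= tr_commutator_mul sub0r !mulrN mulrCA.
rewrite /feedback; move: wreal; case: (\tr _) => a b /= ->.
by have := mulr_ge0 (ltW k0) (sqr_ge0 a); lra.
Qed.

End Decrease.

(** * Derivatives of matrix curves and of their limits at infinity *)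

Section Curves.
Context {R : realType} {n : nat}.
Local Notation op := 'M[R[i]]_n.

Lemma hsnorm0 : hsnorm (0 : op) = 0.
Proof.
rewrite hsnormE big1 ?sqrtr0 // => j _; rewrite big1 // => i _.
by rewrite mxE /= expr0n addr0.
Qed.

Lemma Re_real_mul (c : R) (z : R[i]) : complex.Re (c%:C * z) = c * complex.Re z.
Proof. by case: z => a b /=; rewrite mul0r subr0. Qed.

Lemma Im_real_mul (c : R) (z : R[i]) : complex.Im (c%:C * z) = c * complex.Im z.
Proof. by case: z => a b /=; rewrite mul0r addr0. Qed.

Lemma ReB (z w : R[i]) : complex.Re (z - w) = complex.Re z - complex.Re w.
Proof. by case: z w => a b [c d]. Qed.

Lemma ImB (z w : R[i]) : complex.Im (z - w) = complex.Im z - complex.Im w.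
Proof. by case: z w => a b [c d]. Qed.

Lemma has_derivative_within_entries (D : set R) (X : R -> op) t L i j :
  nbhs t D -> has_derivative_within D X t L ->
  is_derive t 1 (fun s => complex.Re (X s i j)) (complex.Re (L i j)) /\
  is_derive t 1 (fun s => complex.Im (X s i j)) (complex.Im (L i j)).
Proof.
move=> Dt /matrix_cvg_hsnorm /(_ i j)[cr ci].
split; apply: (within_slope_is_derive Dt).
  rewrite (_ : (fun s => _) = fun s =>
    complex.Re (((s - t)^-1%:C *: (X s - X t)) i j)); first exact: cr.
  by apply/funext => s; rewrite !mxE Re_real_mul ReB.
rewrite (_ : (fun s => _) = fun s =>
  complex.Im (((s - t)^-1%:C *: (X s - X t)) i j)); first exact: ci.
by apply/funext => s; rewrite !mxE Im_real_mul ImB.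
Qed.

Lemma tr_square_slope (C q : op) (h : R[i]) : h != 0 ->
  h^-1 * (\tr ((C + h *: q) *m (C + h *: q)) - \tr (C *m C)) =
  \tr (q *m (2 *: C + h *: q)).
Proof.
move=> h0; rewrite !mulmxDl !mulmxDr -!scalemxAr -!scalemxAl.
rewrite !mxtraceD !mxtraceZ [\tr (C *m q)]mxtrace_mulC.
by field.
Qed.

(** The difference quotient of the quadratic form is exactly a polynomial in [s - t] and the
    quotient [q] of [A - B], so its limit follows from [q] tending to [A' - B']. The factor [2^-1]
    cancels the [2] of the product rule. *)
Lemma lyapunov_is_derive (D : set R) (A B : R -> op) t (A' B' : op) :
  nbhs t D -> has_derivative_within D A t A' -> has_derivative_within D B t B' ->
  is_derive t 1 (fun s => lyapunov (A s) (B s))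
    (complex.Re (\tr ((A' - B') *m (A t - B t)))).
Proof.
move=> Dt /matrix_cvg_hsnorm dA /matrix_cvg_hsnorm dB.
apply: (within_slope_is_derive Dt).
pose q s := (s - t)^-1%:C *: (A s - A t) - (s - t)^-1%:C *: (B s - B t).
pose C := A t - B t.
have Cq s : A s - B s = C + (s - t)%:C *: q s.
  rewrite /q /C -scalerBr scalerA -rmorphM; have [->|st] := eqVneq s t.
    by rewrite subrr mul0r scale0r addr0.
  by rewrite mulfV ?subr_eq0// scale1r; apply/matrixP => i j; rewrite !mxE; ring.
rewrite (_ : (fun s => _) = fun s => complex.Re
   (2^-1 * \tr (q s *m (2 *: C + (s - t)%:C *: q s)))); last first.
  apply/funext => s; rewrite /lyapunov -ReB -Re_real_mul Cq; congr complex.Re.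
  rewrite -mulrBr mulrCA; congr (_ * _).
  (* The equality is one of functions, so it must hold at [s = t] too: there [0^-1 = 0] and both
     sides vanish. *)
  have [->|st] := eqVneq s t.
    have -> : q t = 0 by rewrite /q (subrr (A t)) (subrr (B t)) !scaler0 subrr.
    by rewrite mul0mx mxtrace0 subrr invr0 mul0r.
  rewrite (fmorphV (real_complex R)); apply: tr_square_slope.
  by rewrite fmorph_eq0 subr_eq0.
have alg : function_algebra (converges (R := R) (within D t^')).
  exact: function_algebra_converges.
have c0 : complex_in (converges (within D t^')) (with_limit (fun s => (s - t)%:C) 0).
  split; last exact: cvg_cst.
  apply/cvgrPdist_le => e e0; rewrite /within /=.
  apply: filterS (nbhsx_ballx t _ e0) => s; rewrite /ball /= => ts _ _.
  by rewrite sub0r opprB ltW.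
have cq := matrix_in_sub alg dA dB.
have [+ _] := complex_in_mul alg (complex_in_cst alg 2^-1) (complex_in_tr alg
  (matrix_in_mul alg cq (matrix_in_add alg (matrix_in_cst alg (2 *: C))
     (matrix_in_scale alg c0 cq)))).
rewrite /converges /= scale0r addr0 -scalemxAr mxtraceZ mulrA mulVf ?mul1r // ?pnatr_eq0.
Qed.

Lemma taylor_slope (y : R -> R) (s w K : R) :
  (forall s', `|y s' - y s - (s' - s) * w| <= K * (s' - s) ^+ 2) ->
  (s' - s)^-1 * (y s' - y s) @[s' --> within setT s^'] --> w.
Proof.
move=> yK; apply/cvgrPdist_le => e e0.
(* Within this radius [|K| * |s' - s| <= e]; the [+ 1] keeps the denominator positive. *)
have d0 : 0 < e / (`|K| + 1) by rewrite divr_gt0// ltr_wpDl.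
rewrite /within /=; apply: filterS (nbhsx_ballx s _ d0) => s'.
rewrite /ball /= => sd ss _; rewrite distrC.
have h0 : s' - s != 0 by rewrite subr_eq0.
rewrite (_ : _ - w = (s' - s)^-1 * (y s' - y s - (s' - s) * w)); last first.
  by field.
rewrite normrM normfV ler_pdivrMl ?normr_gt0// (le_trans (yK s'))//.
rewrite -real_normK ?num_real// expr2 mulrA mulrC ler_wpM2l//.
move: sd; rewrite distrC ltr_pdivlMr ?ltr_wpDl// => /ltW; apply: le_trans.
by rewrite mulrC ler_wpM2l// (le_trans (ler_norm K))// lerDl.
Qed.

(** The Taylor bound at [t + s'] and [t + s] has a right-hand side free of [t], so pointwise
    convergence at these two translates suffices. *)
Lemma taylor_limit (F : set_system R) (u v : R -> R) (K s s' y y' w : R) :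
  ProperFilter F -> pinfty_nbhs R `<=` F ->
  (forall s t, 0 < s -> 0 < t -> `|u s - u t - (s - t) * v t| <= K * (s - t) ^+ 2) ->
  u (t + s) @[t --> F] --> y -> u (t + s') @[t --> F] --> y' ->
  v (t + s) @[t --> F] --> w ->
  `|y' - y - (s' - s) * w| <= K * (s' - s) ^+ 2.
Proof.
move=> FF oF tay uy uy' vw; rewrite -subr_ge0.
have c : K * (s' - s) ^+ 2 - `|u (t + s') - u (t + s) - (s' - s) * v (t + s)|
    @[t --> F] --> K * (s' - s) ^+ 2 - `|y' - y - (s' - s) * w|.
  apply: cvgB; first exact: cvg_cst.
  by apply: cvg_norm; apply: cvgB; [exact: cvgB|apply: cvgMr].
apply: (@converges_ge0 _ _ F _ (with_limit _ _) c).
(* Beyond this threshold both translated times are positive. *)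
apply: oF; exists (Num.max (- s) (- s')); split; first exact: num_real.
move=> t; rewrite gt_max => /andP[ts ts'] /=.
rewrite subr_ge0; have := tay (t + s') (t + s).
rewrite (_ : t + s' - (t + s) = s' - s); last by ring.
by apply; lra.
Qed.

Lemma near_translate_gt0 (F : set_system R) (s : R) :
  Filter F -> pinfty_nbhs R `<=` F -> \forall t \near F, 0 < t + s.
Proof.
move=> FF oF; apply: oF; exists (- s); split; first exact: num_real.
by move=> t ts /=; lra.
Qed.

Definition entrywise_derivative (X V : R -> op) : Prop :=
  forall (t : R) i j, 0 < t ->
    is_derive t 1 (fun s => complex.Re (X s i j)) (complex.Re (V t i j)) /\
    is_derive t 1 (fun s => complex.Im (X s i j)) (complex.Im (V t i j)).

(* The curve [t |-> X (t + s)] has an ultrafilter limit at infinity for each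
   [s]; the second-order Taylor bound passes to that limit, which replaces the
   uniform convergence of the Arzela-Ascoli theorem. *)
Lemma limit_curve_has_derivative (F : set_system R) (X V Y : R -> op) (W : op) (s : R) :
  UltraFilter F -> pinfty_nbhs R `<=` F ->
  entrywise_derivative X V ->
  matrix_in bounded_lipschitz_on_pos V ->
  (forall r : R, matrix_cvg F (fun t : R => X (t + r)) (Y r)) ->
  matrix_cvg F (fun t : R => V (t + s)) W ->
  has_derivative_within setT Y s W.
Proof.
move=> UF oF XV Vlip XY VW; have FF : ProperFilter F by apply: ultra_proper.
pose G := within [set: R] s^'.
have cQ : matrix_cvg G (fun s' => (s' - s)^-1%:C *: (Y s' - Y s)) W.
  move=> i j; split.
    rewrite /converges /= (_ : (fun s' => _) = fun s' =>
      (s' - s)^-1 * (complex.Re (Y s' i j) - complex.Re (Y s i j))); last first.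
      by apply/funext => s'; rewrite !mxE Re_real_mul ReB.
    have [K tK] := taylor_on_pos (fun t t0 => (XV t i j t0).1) (Vlip i j).1.
    apply: taylor_slope => s'.
    exact: taylor_limit FF oF tK (XY s i j).1 (XY s' i j).1 (VW i j).1.
  rewrite /converges /= (_ : (fun s' => _) = fun s' =>
    (s' - s)^-1 * (complex.Im (Y s' i j) - complex.Im (Y s i j))); last first.
    by apply/funext => s'; rewrite !mxE Im_real_mul ImB.
  have [K tK] := taylor_on_pos (fun t t0 => (XV t i j t0).2) (Vlip i j).2.
  apply: taylor_slope => s'.
  exact: taylor_limit FF oF tK (XY s i j).2 (XY s' i j).2 (VW i j).2.
have alg : function_algebra (converges (R := R) G).
  exact: function_algebra_converges.
have := hsnorm_cvg (matrix_in_sub alg cQ (matrix_in_cst alg W)).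
rewrite /= (subrr W) hsnorm0; exact.
Qed.

Lemma entrywise_bounded_lipschitz (X V : R -> op) : entrywise_derivative X V ->
  matrix_in bounded_on_pos X -> matrix_in bounded_on_pos V ->
  matrix_in bounded_lipschitz_on_pos X.
Proof.
move=> XV Xb Vb i j; split.
  apply: (bounded_derivative_lipschitz (fun t t0 => (XV t i j t0).1)).
    exact: (Xb i j).1.
  exact: (Vb i j).1.
apply: (bounded_derivative_lipschitz (fun t t0 => (XV t i j t0).2)).
  exact: (Xb i j).2.
exact: (Vb i j).2.
Qed.

End Curves.

(** * The closed-loop system and its limit solutions *)

Section ClosedLoop.
Context {R : realType} {n : nat}.
Local Notation op := 'M[R[i]]_n.
Variables (H0 H1 sigma : op) (kappa : R) (rho rhod : R -> op).
Hypothesis hH1 : H1 \is hermsymmx.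
Hypothesis kappa_gt0 : 0 < kappa.
Hypothesis sol : solution_on [set t : R | 0 <= t] H0 H1 sigma kappa rho rhod.

Let field A B : op :=
  - 'i%C *: commutator (H0 + feedback H1 kappa A B *: H1) A.
Let fieldd B : op := - 'i%C *: commutator H0 B.

Lemma nbhs_half_line (t : R) : 0 < t -> nbhs t [set s : R | 0 <= s].
Proof.
move=> t0; apply: filterS (nbhsx_ballx t _ t0) => s; rewrite /ball /=.
by rewrite ltr_norml => /andP[]; lra.
Qed.

Lemma solution_entrywise_derivative :
  entrywise_derivative rho (fun t => field (rho t) (rhod t)) /\
  entrywise_derivative rhod (fun t => fieldd (rhod t)).
Proof.
split=> t i j t0; have [_ _ d dd] := sol (ltW t0).
  exact: (has_derivative_within_entries i j (nbhs_half_line t0) d).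
exact: (has_derivative_within_entries i j (nbhs_half_line t0) dd).
Qed.

Lemma matrix_in_bounded_density (X : R -> op) :
  (forall t : R, 0 < t -> density (X t)) -> matrix_in bounded_on_pos X.
Proof.
by move=> dX i j; split; exists 1 => t /dX /(density_entry_le1 i j)[].
Qed.

Lemma matrix_in_fieldd (X : Type) (P : set (X -> R)) (B : X -> op) :
  function_algebra P -> matrix_in P B -> matrix_in P (fun x => fieldd (B x)).
Proof.
move=> alg PB; exact: (matrix_in_scale alg (complex_in_cst alg _)
  (matrix_in_commutator alg (matrix_in_cst alg H0) PB)).
Qed.

Lemma solution_bounded :
  matrix_in bounded_on_pos rho /\ matrix_in bounded_on_pos rhod.
Proof.
by split; apply: matrix_in_bounded_density => t t0; have [[? _] [? _] _ _] := sol (ltW t0).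
Qed.

(** A bootstrap: bounded states have bounded velocities, so the states are Lipschitz, and then so
    are the velocities, being polynomial in the states. *)
Lemma solution_field_lipschitz :
  matrix_in bounded_lipschitz_on_pos (fun t => field (rho t) (rhod t)) /\
  matrix_in bounded_lipschitz_on_pos (fun t => fieldd (rhod t)).
Proof.
have [b bd] := solution_bounded; have [d dd] := solution_entrywise_derivative.
have algb := @function_algebra_bounded R.
have algl := @function_algebra_bounded_lipschitz R.
have l := entrywise_bounded_lipschitz d b (matrix_in_field algb H0 H1 kappa b bd).
have ld := entrywise_bounded_lipschitz dd bd (matrix_in_fieldd algb bd).
split; first exact: (matrix_in_field algl H0 H1 kappa l ld).
exact: matrix_in_fieldd algl ld.
Qed.

Lemma lyapunov_nonincreasing (s t : R) : 0 < s -> s <= t ->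
  lyapunov (rho t) (rhod t) <= lyapunov (rho s) (rhod s).
Proof.
apply: (@nonincreasing_on_pos _ (fun r => lyapunov (rho r) (rhod r))
  (fun r => complex.Re (\tr ((field (rho r) (rhod r) - fieldd (rhod r)) *m
                             (rho r - rhod r))))) => r r0.
  have [_ _ d dd] := sol (ltW r0).
  exact: lyapunov_is_derive (nbhs_half_line r0) d dd.
have [[[h _ _] _] [[hd _ _] _] _ _] := sol (ltW r0).
exact: lyapunov_rate_le0.
Qed.

Lemma lyapunov_cvg_pinfty :
  exists c : R, lyapunov (rho t) (rhod t) @[t --> +oo] --> c.
Proof.
(* Monotonicity is known at positive times only; freezing the time below [1] makes [g] nondecreasing
   on the whole line. *)
pose g t := - lyapunov (rho (Num.max 1 t)) (rhod (Num.max 1 t)).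
have max0 t : 0 < Num.max 1 t :> R by rewrite lt_max ltr01.
have gc : g t @[t --> +oo] --> sup (range g).
  apply: nondecreasing_cvgr.
    move=> s t st; rewrite lerN2 lyapunov_nonincreasing//.
    by rewrite ge_max !le_max lexx st orbT.
  have [b bd] := solution_bounded.
  have [M VM] := function_algebra_lyapunov (@function_algebra_bounded R) b bd.
  exists M => _ [t _ <-]; rewrite (le_trans (ler_norm _))// normrN.
  exact: VM.
exists (- sup (range g)); apply: cvg_trans (cvgN gc).
apply: near_eq_cvg; exists 1; split => // t t1.
by rewrite /= /g /= opprK max_r// ltW.
Qed.

Lemma ultra_limit_in_invariant_set (F : set_system R) :
  UltraFilter F -> pinfty_nbhs R `<=` F ->
  exists2 p, invariant_set H0 H1 sigma kappa p &
    matrix_cvg F rho p.1 /\ matrix_cvg F rhod p.2.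
Proof.
move=> UF oF; have FF : ProperFilter F by apply: ultra_proper.
have pos s : \forall t \near F, 0 < t + s by exact: near_translate_gt0.
(* Negative [s] is allowed, since [t + s] is positive for [F]-almost all [t]; this is how a forward
   solution yields one on the whole line. *)
pose Y (s : R) := mxlim F (fun t => rho (t + s)).
pose Yd (s : R) := mxlim F (fun t => rhod (t + s)).
have dens t : 0 < t -> density (rho t) /\ density (rhod t).
  by move=> t0; have [[? _] [? _]] := sol (ltW t0).
have cY s : matrix_cvg F (fun t => rho (t + s)) (Y s).
  apply: (mxlim_cvg (M := 1) UF) => i j.
  by apply: filterS (pos s) => t /dens[/(density_entry_le1 i j)].
have cYd s : matrix_cvg F (fun t => rhod (t + s)) (Yd s).
  apply: (mxlim_cvg (M := 1) UF) => i j.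
  by apply: filterS (pos s) => t /dens[_ /(density_entry_le1 i j)].
have alg : function_algebra (converges (R := R) F).
  exact: function_algebra_converges.
have mY s : isospectral_manifold sigma (Y s).
  apply: (isospectral_manifold_closed FF (cY s)).
  by apply: filterS (pos s) => t t0; have [] := sol (ltW t0).
have mYd s : isospectral_manifold sigma (Yd s).
  apply: (isospectral_manifold_closed FF (cYd s)).
  by apply: filterS (pos s) => t t0; have [] := sol (ltW t0).
have [d dd] := solution_entrywise_derivative.
have [l ld] := solution_field_lipschitz.
exists (Y 0, Yd 0); last first.
  split.
    by have := cY 0; under [fun t => rho _]funext do rewrite addr0.
  by have := cYd 0; under [fun t => rhod _]funext do rewrite addr0.
split; first exact: mY.
split; first exact: mYd.
exists Y, Yd; split=> //.
- move=> s _; split=> //.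
    apply: (limit_curve_has_derivative UF oF d l cY).
    (* The limit of the velocities is the field at the limit point, because the field is
       polynomial. *)
    exact: (matrix_in_field alg H0 H1 kappa (cY s) (cYd s)).
  apply: (limit_curve_has_derivative UF oF dd ld cYd).
  exact: (matrix_in_fieldd alg (cYd s)).
- have [c Vc] := lyapunov_cvg_pinfty.
  (* Translating time by [s] does not change the limit of [V] at infinity. *)
  have Vconst s : lyapunov (Y s) (Yd s) = c.
    have V1 := function_algebra_lyapunov alg (cY s) (cYd s).
    have V2 : lyapunov (rho (t + s)) (rhod (t + s)) @[t --> F] --> c.
      have : lyapunov (rho (t + s)) (rhod (t + s)) @[t --> +oo] --> c.
        exact: (cvg_comp _ _ (cvg_addrr s) Vc).
      by apply: cvg_trans => A; apply: oF.
    by apply: (cvg_unique _ V1 V2); apply: Rhausdorff.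
  move=> t; rewrite (_ : (fun s => _) = cst c); first exact: is_derive_cst.
  exact/funext.
Qed.

(** The limit point may depend on the ultrafilter, but the distance to the set is at most the
    distance to that point, so it tends to [0] along each of them. *)
Lemma dist_to_invariant_set_cvg :
  dist_to_set (rho t, rhod t) (invariant_set H0 H1 sigma kappa)
    @[t --> +oo] --> 0%E.
Proof.
apply: cvg_ultra => F UF oF; have FF : ProperFilter F by apply: ultra_proper.
have [[P Pd] pE [/= cP cPd]] := ultra_limit_in_invariant_set UF oF.
have alg : function_algebra (converges (R := R) F).
  exact: function_algebra_converges.
have c : pair_dist (rho t, rhod t) (P, Pd) @[t --> F] --> (0 : R).
  have h : hsnorm (rho t - P) @[t --> F] --> (0 : R).
    have := hsnorm_cvg (matrix_in_sub alg cP (matrix_in_cst alg P)).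
    by rewrite /= (subrr P) hsnorm0; apply.
  have hd : hsnorm (rhod t - Pd) @[t --> F] --> (0 : R).
    have := hsnorm_cvg (matrix_in_sub alg cPd (matrix_in_cst alg Pd)).
    by rewrite /= (subrr Pd) hsnorm0; apply.
  have := cvg_comp _ _ (cvgD (cvgM h h) (cvgM hd hd)) (@sqrt_continuous R _).
  by rewrite mul0r addr0 sqrtr0; apply.
have cE : (pair_dist (rho t, rhod t) (P, Pd))%:E @[t --> F] --> 0%E.
  by apply: cvg_EFin; [exact: filterE|exact: c].
apply: (squeeze_cvge _ (cvg_cst 0%E) cE); apply: filterE => t.
apply/andP; split; last by apply: ereal_inf_lbound; exists (P, Pd).
by apply: le_ereal_inf_tmp => _ [q _ <-]; rewrite lee_fin sqrtr_ge0.
Qed.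

End ClosedLoop.

Theorem mainTheorem1 (R : realType) (n : nat)
    (H0 H1 sigma : 'M[R[i]]_n) (kappa : R)
    (hH0 : H0 \is hermsymmx) (hH1 : H1 \is hermsymmx)
    (hsigma : density sigma) (hkappa : 0 < kappa)
    (rho rhod : R -> 'M[R[i]]_n)
    (hsol : solution_on [set t : R | 0 <= t] H0 H1 sigma kappa rho rhod) :
  dist_to_set (rho t, rhod t) (invariant_set H0 H1 sigma kappa)
    @[t --> +oo] --> 0%E.
Proof. exact: dist_to_invariant_set_cvg. Qed.
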